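(* Every Garside group $G$ is of type $FL$, i.e. $\mathbb{Z}$ (with trivial $G$-action) admits a finite free resolution over $\mathbb{Z}G$.
   Context: Let $M$ be a monoid. For $x,y\in M$: $x$ is a left divisor of $y$, and $y$ a right multiple of $x$, if $y=xz$ for some $z$; the divisor is proper if one can take $z\ne 1$. Right divisors and left multiples are defined symmetrically ($y=zx$). $M$ is left Noetherian if there is no infinite sequence in which each term has the next one as a proper left divisor; right Noetherian is the symmetric notion. A left lcm of $x,y$ is a common left multiple of which every common left multiple of $x,y$ is a left multiple; right lcm is symmetric. $M$ is left Gaussian if it is right cancellative ($xz=yz\Rightarrow x=y$), left Noetherian, and any two elements admit a left lcm; right Gaussian is the symmetric notion (left cancellative, right Noetherian, any two elements admit a right lcm). $M$ is Gaussian if it is both left and right Gaussian. In a Gaussian monoid write $x\vee y$ for the left lcm and let the left complement $x_{/y}$ be the unique element with $x_{/y}\cdot y=x\vee y$; symmetrically the right complement ${}_{x\backslash}y$ is the unique element such that $x\cdot{}_{x\backslash}y$ is the right lcm of $x$ and $y$. $M$ is a Garside monoid if it is Gaussian and has a finite generating subset $\mathcal{X}$ such that for all $x,y\in\mathcal X$ the left and right lcm's of $x,y$ belong to $\mathcal X$ and the left and right complements of $x,y$ belong to $\mathcal X\cup\{1\}$. A Gaussian monoid satisfies Ore's conditions, hence embeds in a group of fractions; a Garside group is the group of fractions of a Garside monoid. A finite free resolution of $\mathbb{Z}$ over $\mathbb{Z}G$ is an exact sequence $0\to F_k\to\cdots\to F_0\to\mathbb{Z}\to 0$ of $\mathbb{Z}G$-modules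 with each $F_i$ free of finite rank. *)

(* Defs.v *)
From HB Require Import structures.
From mathcomp Require Import all_boot all_order all_algebra.
From mathcomp Require Import finmap.
From mathcomp.multinomials Require Import monalg.

Set Implicit Arguments.
Unset Strict Implicit.
Unset Printing Implicit Defensive.

Import GRing.Theory.

Section Garside.
Local Open Scope group_scope.
Variable M : monoidType.
Implicit Types (x y z m n c : M) (X : seq M).

(* "y is a right (resp. left) multiple of x" is written [left_divisor x y]
   (resp. [right_divisor x y]). *)
Definition left_divisor x y : Prop := exists z, y = x * z.
Definition right_divisor x y : Prop := exists z, y = z * x.

Definition proper_left_divisor x y : Prop := exists2 z, y = x * z & z <> 1.
Definition proper_right_divisor x y : Prop := exists2 z, y = z * x & z <> 1.

Definition left_noetherian : Prop :=
  ~ exists u : nat -> M, forall i, proper_left_divisor (u i.+1) (u i).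
Definition right_noetherian : Prop :=
  ~ exists u : nat -> M, forall i, proper_right_divisor (u i.+1) (u i).

Definition left_cancellative : Prop := forall x y z, z * x = z * y -> x = y.
Definition right_cancellative : Prop := forall x y z, x * z = y * z -> x = y.

Definition left_lcm x y m : Prop :=
  [/\ right_divisor x m, right_divisor y m
    & forall n, right_divisor x n -> right_divisor y n -> right_divisor m n].
Definition right_lcm x y m : Prop :=
  [/\ left_divisor x m, left_divisor y m
    & forall n, left_divisor x n -> left_divisor y n -> left_divisor m n].

Definition left_gaussian : Prop :=
  [/\ right_cancellative, left_noetherian
    & forall x y, exists m, left_lcm x y m].
Definition right_gaussian : Prop :=
  [/\ left_cancellative, right_noetherian
    & forall x y, exists m, right_lcm x y m].
Definition gaussian : Prop := left_gaussian /\ right_gaussian.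

(* [left_complement x y c] states c = x_{/y} and [right_complement x y c]
   states c = _{x\}y; in a Gaussian monoid lcm's and complements exist and are
   unique, so these relations are graphs of functions. *)
Definition left_complement x y c : Prop := left_lcm x y (c * y).
Definition right_complement x y c : Prop := right_lcm x y (x * c).

Definition generates X : Prop :=
  forall x, exists2 s : seq M, {subset s <= X} & x = \prod_(y <- s) y.

Definition garside_generators X : Prop :=
  generates X /\ forall x y, x \in X -> y \in X ->
    [/\ forall m, left_lcm x y m -> m \in X,
        forall m, right_lcm x y m -> m \in X,
        forall c, left_complement x y c -> c \in 1 :: X
      & forall c, right_complement x y c -> c \in 1 :: X].

Definition garside_monoid : Prop :=
  gaussian /\ exists X, garside_generators X.

(* G is the group of (left) fractions of M, via the embedding f. *)
Definition group_of_fractions (G : groupType) (f : M -> G) : Prop :=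
  [/\ f 1 = 1, {morph f : x y / x * y}, injective f
    & forall g : G, exists x y, g = (f x)^-1 * f y].

End Garside.

Definition garside_group (G : groupType) : Prop :=
  exists (M : monoidType) (f : M -> G),
    garside_monoid M /\ group_of_fractions f.

Local Open Scope ring_scope.

(* The ring structure that multinomials puts on {malg R[K]} requires a monoid K
   without nontrivial units, so ZG is an alias of the free abelian group
   {malg int[G]}, equipped here with the convolution product. *)
Definition group_ring (G : groupType) : Type := {malg int[G]}.
HB.instance Definition _ (G : groupType) := GRing.Zmodule.on (group_ring G).

Section GroupRing.
Variable G : groupType.
Local Notation ZG := (group_ring G).
Implicit Types a b c : ZG.

Definition gr_one : ZG := << 1%g >>.
Definition gr_mul a b : ZG :=
  \sum_(g <- msupp a) \sum_(h <- msupp b) << a@_g * b@_h *g (g * h)%g >>.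
Definition augmentation a : int := \sum_(g <- msupp a) a@_g.

Lemma gr_mulw (d e : {fset G}) a b :
  (msupp a `<=` d)%fset -> (msupp b `<=` e)%fset ->
  gr_mul a b = \sum_(g <- d) \sum_(h <- e) << a@_g * b@_h *g (g * h)%g >>.
Proof.
move=> le_d le_e; rewrite /gr_mul (big_fset_incl _ le_d) /=.
  apply/eq_bigr=> g _; apply/big_fset_incl => // h _ /mcoeff_outdom ->.
  by rewrite mulr0 monalgU0.
move=> g _ /mcoeff_outdom ag; rewrite big1 // => h _.
by rewrite ag mul0r monalgU0.
Qed.

Lemma gr_mulUU (x y : int) (g h : G) :
  gr_mul << x *g g >> << y *g h >> = << x * y *g (g * h)%g >>.
Proof. by rewrite (gr_mulw msuppU_le msuppU_le) !big_seq_fset1 !mcoeffUU. Qed.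

Lemma gr_mulDl : left_distributive gr_mul +%R.
Proof.
move=> a b c; set d := (msupp a `|` msupp b)%fset.
rewrite (@gr_mulw d (msupp c)) ?fsubset_refl ?msuppD_le //.
rewrite (@gr_mulw d (msupp c) a) ?fsubset_refl ?fsubsetUl //.
rewrite (@gr_mulw d (msupp c) b) ?fsubset_refl ?fsubsetUr //.
rewrite -big_split /=; apply/eq_bigr=> g _; rewrite -big_split.
by apply/eq_bigr=> h _; rewrite mcoeffD mulrDl monalgUD.
Qed.

Lemma gr_mulDr : right_distributive gr_mul +%R.
Proof.
move=> c a b; set d := (msupp a `|` msupp b)%fset.
rewrite (@gr_mulw (msupp c) d) ?fsubset_refl ?msuppD_le //.
rewrite (@gr_mulw (msupp c) d c a) ?fsubset_refl ?fsubsetUl //.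
rewrite (@gr_mulw (msupp c) d c b) ?fsubset_refl ?fsubsetUr //.
rewrite -big_split /=; apply/eq_bigr=> g _; rewrite -big_split.
by apply/eq_bigr=> h _; rewrite mcoeffD mulrDr monalgUD.
Qed.

Lemma gr_mul0l : left_zero 0 gr_mul.
Proof. by move=> a; rewrite /gr_mul msupp0 big_seq_fset0. Qed.

Lemma gr_mul0r : right_zero 0 gr_mul.
Proof.
by move=> a; rewrite /gr_mul big1 // => g _; rewrite msupp0 big_seq_fset0.
Qed.

Lemma gr_mul_suml (I : Type) (r : seq I) (F : I -> ZG) b :
  gr_mul (\sum_(i <- r) F i) b = \sum_(i <- r) gr_mul (F i) b.
Proof.
exact: (big_morph (gr_mul^~ b) (fun _ _ => gr_mulDl _ _ _) (gr_mul0l b)).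
Qed.

Lemma gr_mul_sumr (I : Type) (r : seq I) (F : I -> ZG) a :
  gr_mul a (\sum_(i <- r) F i) = \sum_(i <- r) gr_mul a (F i).
Proof.
exact: (big_morph (gr_mul a) (fun _ _ => gr_mulDr _ _ _) (gr_mul0r a)).
Qed.

Lemma gr_mulEl a b :
  gr_mul a b = \sum_(g <- msupp a) gr_mul << a@_g *g g >> b.
Proof. by rewrite [in LHS](monalgE a) gr_mul_suml. Qed.

Lemma gr_mulEr a b :
  gr_mul a b = \sum_(h <- msupp b) gr_mul a << b@_h *g h >>.
Proof. by rewrite [in LHS](monalgE b) gr_mul_sumr. Qed.

Lemma gr_mul1l : left_id gr_one gr_mul.
Proof.
move=> a; rewrite gr_mulEr [RHS]monalgE.
by apply: eq_bigr => g _; rewrite gr_mulUU mul1r mul1g.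
Qed.

Lemma gr_mul1r : right_id gr_one gr_mul.
Proof.
move=> a; rewrite gr_mulEl [RHS]monalgE.
by apply: eq_bigr => g _; rewrite gr_mulUU mulr1 mulg1.
Qed.

Lemma gr_mulA : associative gr_mul.
Proof.
move=> a b c; rewrite gr_mulEl (gr_mulEl a b) gr_mul_suml.
apply: eq_bigr => g _; rewrite (gr_mulEl b c) (gr_mulEr _ b).
rewrite gr_mul_sumr gr_mul_suml; apply: eq_bigr => h _.
rewrite gr_mulUU (gr_mulEr _ c) (gr_mulEr _ c) gr_mul_sumr.
by apply: eq_bigr => k _; rewrite !gr_mulUU mulrA mulgA.
Qed.

Lemma gr_oner_neq0 : gr_one != 0.
Proof. by rewrite monalgU_eq0 oner_eq0. Qed.

HB.instance Definition _ := GRing.Zmodule_isNzRing.Build ZG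
  gr_mulA gr_mul1l gr_mul1r gr_mulDl gr_mulDr gr_oner_neq0.

Lemma augmentationw (d : {fset G}) a :
  (msupp a `<=` d)%fset -> augmentation a = \sum_(g <- d) a@_g.
Proof. by move=> le_d; apply/big_fset_incl => // g _ /mcoeff_outdom. Qed.

Lemma augmentationD : {morph augmentation : a b / a + b}.
Proof.
move=> a b; rewrite (augmentationw (msuppD_le a b)).
rewrite (augmentationw (fsubsetUl (msupp a) (msupp b))).
rewrite (augmentationw (fsubsetUr (msupp a) (msupp b))).
by rewrite -big_split /=; apply/eq_bigr=> g _; rewrite mcoeffD.
Qed.

Lemma augmentationU (x : int) (g : G) : augmentation << x *g g >> = x.
Proof. by rewrite (augmentationw msuppU_le) big_seq_fset1 mcoeffUU. Qed.

Lemma augmentation_sum (I : Type) (r : seq I) (F : I -> ZG) :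
  augmentation (\sum_(i <- r) F i) = \sum_(i <- r) augmentation (F i).
Proof.
apply: (big_morph _ augmentationD).
by rewrite /augmentation msupp0 big_seq_fset0.
Qed.

Lemma augmentationM : {morph augmentation : a b / a * b}.
Proof.
move=> a b; rewrite augmentation_sum mulr_suml; apply/eq_bigr=> g _.
rewrite augmentation_sum mulr_sumr; apply/eq_bigr=> h _.
by rewrite augmentationU.
Qed.

End GroupRing.

(* The ZG-module Z on which every element of G acts as the identity; thus ZG
   acts through the augmentation. *)
Definition trivial_module (G : groupType) : Type := int.
HB.instance Definition _ (G : groupType) := GRing.Zmodule.on (trivial_module G).

Section TrivialModule.
Variable G : groupType.

Definition trivial_scale (a : group_ring G) (m : trivial_module G) :
  trivial_module G := (augmentation a * m)%R.

Lemma trivial_scaleA a b m :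
  trivial_scale a (trivial_scale b m) = trivial_scale (a * b) m.
Proof. by rewrite /trivial_scale augmentationM mulrA. Qed.

Lemma trivial_scale1 : left_id 1 trivial_scale.
Proof. by move=> m; rewrite /trivial_scale augmentationU mul1r. Qed.

Lemma trivial_scaleDr : right_distributive trivial_scale +%R.
Proof. by move=> a m n; apply: mulrDr. Qed.

Lemma trivial_scaleDl m : {morph trivial_scale^~ m : a b / a + b}.
Proof. by move=> a b; rewrite /trivial_scale augmentationD mulrDl. Qed.

HB.instance Definition _ :=
  GRing.Zmodule_isLmodule.Build (group_ring G) (trivial_module G)
    trivial_scaleA trivial_scale1 trivial_scaleDr trivial_scaleDl.

Lemma trivial_moduleE (g : G) (m : trivial_module G) :
  (<< g >> : group_ring G) *: m = m.
Proof. by rewrite /GRing.scale /= /trivial_scale augmentationU mul1r. Qed.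

End TrivialModule.

Definition free_of_finite_rank (R : nzRingType) (V : lmodType R) : Prop :=
  exists (n : nat) (e : 'I_n -> V),
    forall v : V, exists! c : {ffun 'I_n -> R}, v = \sum_(i < n) c i *: e i.

(* 0 -> F_k -> ... -> F_0 -> V -> 0, with the sequence F extended by zero beyond
   k; exactness at F_k then says that F_k -> F_(k-1) (or F_0 -> V when k = 0)
   is injective. *)
Definition has_finite_free_resolution (R : nzRingType) (V : lmodType R) :
    Prop :=
  exists (k : nat) (F : nat -> lmodType R)
         (d : forall i, {linear F i.+1 -> F i}) (eps : {linear F 0%N -> V}),
    [/\ forall i, (i <= k)%N -> free_of_finite_rank (F i),
        forall i, (k < i)%N -> forall x : F i, x = 0,
        forall v, exists x, eps x = v,
        forall x, eps x = 0 <-> exists y, x = d 0%N y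
      & forall i (x : F i.+1), d i x = 0 <-> exists y, x = d i.+1 y].

Definition type_FL (G : groupType) : Prop :=
  has_finite_free_resolution (trivial_module G).

(* Main.v *)
(* Put S = {1} u X, call (g_0, ..., g_n) a step chain when g_i^-1 g_j lies in S
   and g_i <> g_j for all i < j, and let G act by left translation.  Since S is
   finite, step chains have bounded length, and there are finitely many of each
   length up to the free action of G; so the simplicial complex of step chains
   yields a bounded complex of finite free ZG-modules, and only its acyclicity
   has to be shown.
   Translating a cycle by a common denominator moves its vertices into M.
   There, the right divisors in S of an element m <> 1 have a greatest one t,
   because S is closed under left lcm's; put m = pi(m) t.  As S is closed under
   left complements, a chain ending at m stays a (possibly degenerate) step
   chain when pi(m) is put in front.  This is a homotopy from the identity to a
   chain map that strictly lowers the last vertex for left divisibility, and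
   which is therefore locally nilpotent by left Noetherianity. *)
Require Import Defs.
From mathcomp Require Import all_boot.
From HB Require Import structures.
From mathcomp Require Import all_order all_algebra finmap boolp.
From mathcomp.multinomials Require Import monalg.

Set Implicit Arguments.
Unset Strict Implicit.
Unset Printing Implicit Defensive.

Import GRing.Theory.
Local Open Scope ring_scope.

Definition supported (K : choiceType) (P : K -> Prop) (c : {malg int[K]}) :=
  forall k, k \in msupp c -> P k.

(** * Linear extension to finitely supported chains *)

Section Lift.
Variables (K : choiceType) (V : zmodType).
Implicit Types (phi psi : K -> V) (c d : {malg int[K]}).

Definition malg_lift phi c : V := \sum_(k <- msupp c) phi k *~ c@_k.

Lemma malg_liftw (D : {fset K}) phi c : (msupp c `<=` D)%fset ->
  malg_lift phi c = \sum_(k <- D) phi k *~ c@_k.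
Proof.
by move=> le; apply/big_fset_incl => // k _ /mcoeff_outdom ->; rewrite mulr0z.
Qed.

Lemma malg_lift_is_zmod_morphism phi : zmod_morphism (malg_lift phi).
Proof.
move=> c d; set D := (msupp c `|` msupp d)%fset.
rewrite (@malg_liftw D _ (c - d)) ?msuppB_le //.
rewrite (@malg_liftw D _ c) ?fsubsetUl // (@malg_liftw D _ d) ?fsubsetUr //.
by rewrite -sumrB; apply: eq_bigr => k _; rewrite mcoeffB mulrzBr.
Qed.

HB.instance Definition _ phi :=
  GRing.isZmodMorphism.Build {malg int[K]} V (malg_lift phi)
    (malg_lift_is_zmod_morphism phi).

Lemma malg_liftU phi k : malg_lift phi << k >> = phi k.
Proof.
by rewrite (malg_liftw _ (@msuppU_le _ _ k 1)) big_seq_fset1 mcoeffUU mulr1z.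
Qed.

Lemma eq_malg_lift phi psi c :
  supported (fun k => phi k = psi k) c -> malg_lift phi c = malg_lift psi c.
Proof. by move=> e; apply: eq_big_seq => k /e ->. Qed.

Lemma malg_liftB phi psi c :
  malg_lift (fun k => phi k - psi k) c = malg_lift phi c - malg_lift psi c.
Proof. by rewrite -sumrB; apply: eq_bigr => k _; rewrite mulrzBl. Qed.

End Lift.

Lemma raddf_lift (K : choiceType) (V W : zmodType) (A : {additive V -> W})
    (phi : K -> V) (c : {malg int[K]}) :
  A (malg_lift phi c) = malg_lift (fun k => A (phi k)) c.
Proof. by rewrite raddf_sum; apply: eq_bigr => k _; rewrite raddfMz. Qed.

Section Support.
Variable K : choiceType.
Implicit Types (P Q : K -> Prop) (c d : {malg int[K]}).

Lemma malg_lift_id c : malg_lift (fun k => << k >>) c = c.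
Proof.
rewrite [RHS]monalgE; apply: eq_bigr => k _; apply/malgP => x.
by rewrite raddfMz /= !mcoeffU; case: eqP => _; rewrite ?mul0rz // mulr1n intz.
Qed.

Lemma raddf_malg (V : zmodType) (A : {additive {malg int[K]} -> V}) c :
  A c = malg_lift (fun k => A << k >>) c.
Proof. by rewrite -raddf_lift malg_lift_id. Qed.

Lemma sub_supported P Q c :
  (forall k, P k -> Q k) -> supported P c -> supported Q c.
Proof. by move=> PQ Pc k /Pc /PQ. Qed.

Lemma supported0 P : supported P 0.
Proof. by move=> k; rewrite msupp0. Qed.

Lemma supportedU P k : P k -> supported P << k >>.
Proof. by move=> Pk x /(fsubsetP msuppU_le); rewrite in_fset1 => /eqP ->. Qed.

Lemma supportedD P c d : supported P c -> supported P d -> supported P (c + d).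
Proof.
by move=> Pc Pd k /(fsubsetP (msuppD_le _ _));
  rewrite in_fsetU => /orP[/Pc|/Pd].
Qed.

Lemma supportedN P c : supported P c -> supported P (- c).
Proof. by move=> Pc k; rewrite msuppN => /Pc. Qed.

Lemma supportedB P c d : supported P c -> supported P d -> supported P (c - d).
Proof. by move=> Pc Pd; apply: supportedD => //; apply: supportedN. Qed.

Lemma supportedMz P c z : supported P c -> supported P (c *~ z).
Proof.
by move=> Pc; rewrite -scaler_int => k /(fsubsetP (msuppZ_le _ _))/Pc.
Qed.

End Support.

Lemma supported_lift (K L : choiceType) (P : K -> Prop) (Q : L -> Prop)
    (phi : K -> {malg int[L]}) (c : {malg int[K]}) :
  supported P c -> (forall k, P k -> supported Q (phi k)) ->
  supported Q (malg_lift phi c).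
Proof.
move=> Pc PQ; rewrite /malg_lift big_seq.
elim/big_ind: _ => [|x y|k /Pc/PQ]; first exact: supported0.
- exact: supportedD.
- exact: supportedMz.
Qed.

(** * A homotopy on augmented simplicial chains *)

Section Chains.
Variable T : choiceType.
Local Notation C := {malg int[seq T]}.
Implicit Types (s t : seq T) (c : C) (x p : T).

Definition cone x : C -> C := malg_lift (fun t => << x :: t >>).
HB.instance Definition _ x := GRing.Additive.on (cone x).

(* The simplicial boundary, augmented by the empty sequence in degree -1. *)
Fixpoint face s : C :=
  if s is x :: t then << t >> - cone x (face t) else 0.

Definition boundary : C -> C := malg_lift face.
HB.instance Definition _ := GRing.Additive.on boundary.

Lemma boundaryU s : boundary << s >> = face s.
Proof. exact: malg_liftU. Qed.

Lemma boundary_cone x c : boundary (cone x c) = c - cone x (boundary c).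
Proof.
rewrite [cone x (boundary c)]raddf_lift -[X in _ = X - _]malg_lift_id.
rewrite -malg_liftB raddf_lift; apply: eq_malg_lift => t _.
by rewrite /= boundaryU.
Qed.

Lemma boundary_face s : boundary (face s) = 0.
Proof.
elim: s => [|x s IHs] /=; first exact: raddf0.
by rewrite raddfB /= boundaryU boundary_cone IHs raddf0 subr0 subrr.
Qed.

Lemma boundaryK c : boundary (boundary c) = 0.
Proof.
rewrite [boundary c]raddf_malg raddf_lift /= /malg_lift big1 // => s _.
by rewrite boundaryU boundary_face mul0rz.
Qed.

Lemma supported_face s :
  supported (fun t => subseq t s /\ size s = (size t).+1) (face s).
Proof.
elim: s => [|x s IHs] /=; first exact: supported0.
apply: supportedB; first by apply: supportedU; split; first exact: subseq_cons.
apply: supported_lift IHs _ => t [st ->]; apply: supportedU.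
by rewrite /= eqxx.
Qed.

Lemma supported_boundary (Q R : seq T -> Prop) c : supported Q c ->
    (forall s t, Q s -> subseq t s -> size s = (size t).+1 -> R t) ->
  supported R (boundary c).
Proof.
move=> sc QR; apply: supported_lift sc _ => s Qs.
by apply: sub_supported (supported_face (s := s)) => t [ts e]; apply: QR e.
Qed.

(** Sorts the faces by whether they keep the last vertex, on which alone the apex of a chain will
    depend. *)
Lemma face_rcons s x :
  face (rcons s x)
    = malg_lift (fun t => << rcons t x >>) (face s) + << s >> *~ (-1) ^+ size s.
Proof.
elim: s => [|y s IHs] /=; first by rewrite !raddf0 add0r addr0 expr0 mulr1z.
have e : malg_lift (fun t => << rcons t x >>) (cone y (face s)) =
    cone y (malg_lift (fun t => << rcons t x >>) (face s)).
  rewrite !raddf_lift; apply: eq_malg_lift => t _ /=.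
  by rewrite malg_liftU /cone malg_liftU.
rewrite IHs raddfB raddfD /= malg_liftU opprD addrA e raddfMz /=.
by rewrite [cone y << s >>]malg_liftU exprS mulN1r mulrNz.
Qed.

(* A repeated vertex gives zero, as in normalized chains. *)
Definition join p s : C := if ohead s == Some p then 0 else << p :: s >>.

Lemma joinE p s : p \notin s -> join p s = << p :: s >>.
Proof.
by rewrite /join; case: s => //= x s; case: eqP => // -[->]; rewrite mem_head.
Qed.

(** If [p] is not the head of [s], this is the boundary of a cone. If it is, [join p] kills [s] and
    every face that keeps the head, while the face without the head is sent back to [s]. *)
Lemma boundary_join p s : p \notin behead s ->
  boundary (join p s) + malg_lift (join p) (face s) = << s >>.
Proof.
case: s => [|x s] /= ps.
  by rewrite /join /= boundaryU /= !raddf0 !addr0.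
rewrite raddfB /= malg_liftU (joinE ps).
have -> : malg_lift (join p) (cone x (face s)) =
    (if x == p then 0 else cone p (cone x (face s))).
  rewrite raddf_lift; case: eqP => [->|xp].
    rewrite /malg_lift big1 // => t _.
    by rewrite /= malg_liftU /join /= eqxx mul0rz.
  rewrite [X in cone p X]/cone raddf_lift; apply: eq_malg_lift => t _.
  by rewrite /= /cone !malg_liftU /join /=; case: eqP => // -[].
rewrite /join /=; case: (eqVneq x p) => [->|xp].
  by rewrite eqxx raddf0 add0r subr0.
case: eqP => [[/eqP]|_]; first by rewrite (negPf xp).
rewrite boundaryU /= raddfB /= [cone p << s >>]malg_liftU.
by rewrite subrK.
Qed.

(** * Contraction of simplices by apexes, for an abstract relation [r] *)

Variables (r : rel T) (P : T -> Prop) (o : T) (pi : T -> T).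

Definition simplex s := pairwise r s /\ forall x, x \in s -> P x.

(** The single vertex [o] arises as the cone over the empty chain, whose last vertex defaults to
    [o]; the second alternative places it below every other vertex. *)
Definition lower x y := [/\ P x, P y & r x y \/ x = o /\ y <> o].

Hypotheses (Po : P o) (pio : pi o = o)
  (r_asym : forall x y, r x y -> r y x -> False)
  (pi_lower : forall x, P x -> x <> o -> P (pi x) /\ r (pi x) x)
  (pi_cone : forall x y, P x -> P y -> r x y -> pi y = x \/ r (pi y) x)
  (lower_wf : forall x, P x -> Acc lower x).

Let P_pi x : P x -> P (pi x).
Proof.
by move=> Px; case: (eqVneq x o) => [->|/eqP/(pi_lower Px)[]]; rewrite ?pio.
Qed.

Let apex s := pi (last o s).

Lemma simplex_sub s t : subseq s t -> simplex t -> simplex s.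
Proof.
move=> st [rt Pt]; split=> [|x xs]; first exact: subseq_pairwise rt.
by apply: Pt; apply: mem_subseq xs.
Qed.

Lemma simplex_last s : simplex s -> P (last o s).
Proof. by case: s => //= x s [_]; apply; rewrite mem_last. Qed.

(** The last vertex is covered by [pi_lower], or by [pio] if it is [o]; the vertices before it are
    related to it, so [pi_cone] applies. *)
Lemma below_apex s x : simplex s -> x \in s -> apex s = x \/ r (apex s) x.
Proof.
rewrite /apex; case/lastP: s => // s m [rs Ps]; rewrite last_rcons => xs.
have Pm : P m by apply: Ps; rewrite mem_rcons mem_head.
move: (Ps _ xs) => Px; move: xs; rewrite mem_rcons inE => /predU1P[->|xs].
  case: (eqVneq m o) => [->|/eqP/(pi_lower Pm)[]]; [by left|by right].
by apply: pi_cone => //; move: rs; rewrite pairwise_rcons => /andP[/allP->].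
Qed.

(** If [p] came after the head [x], then [r x p] would contradict [p = x] or [r p x] by asymmetry.
    So an apex can repeat only the head, which is the degeneracy that [join] discards. *)
Lemma notin_behead p s : simplex s ->
  (forall x, x \in s -> p = x \/ r p x) -> p \notin behead s.
Proof.
case: s => // x s [rs _] ps /=; apply/negP => pin.
have /allP/(_ _ pin) rxp : all (r x) s by case/andP: rs.
case: (ps x (mem_head _ _)) => [e|rpx]; last by case: (r_asym rxp rpx).
by rewrite e in rxp; case: (r_asym rxp rxp).
Qed.

Lemma supported_join p s : P p -> simplex s ->
    (forall x, x \in s -> p = x \/ r p x) ->
  supported (fun t => [/\ simplex t, size t = (size s).+1 & t = p :: s])
    (join p s).
Proof.
move=> Pp Ss ps; rewrite /join; case: eqP => [_|hs]; first exact: supported0.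
apply: supportedU; split=> //; case: (Ss) => rs Ps; split; last first.
  by move=> x; rewrite inE => /predU1P[->|/Ps].
rewrite /= rs andbT; apply/allP => x xs; case: (ps x xs) => // e.
have := notin_behead Ss ps; case: s {Ss ps rs Ps} hs xs => //= y s hs.
rewrite inE -e => /predU1P[yp|->//]; by case: hs; rewrite yp.
Qed.

Definition homotopy : C -> C := malg_lift (fun s => join (apex s) s).
HB.instance Definition _ := GRing.Additive.on homotopy.

Lemma homotopyU s : homotopy << s >> = join (apex s) s.
Proof. exact: malg_liftU. Qed.

Definition descend : C -> C := malg_lift (fun s =>
  << s >> - boundary (join (apex s) s) - homotopy (face s)).
HB.instance Definition _ := GRing.Additive.on descend.

Lemma descendE c :
  descend c = c - boundary (homotopy c) - homotopy (boundary c).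
Proof.
rewrite /descend !malg_liftB malg_lift_id [boundary (homotopy c)]raddf_lift.
by rewrite [homotopy (boundary c)]raddf_lift.
Qed.

Lemma supported_homotopy n c :
  supported (fun s => simplex s /\ size s = n) c ->
  supported (fun s => simplex s /\ size s = n.+1) (homotopy c).
Proof.
move=> sc; apply: supported_lift sc _ => s [Ss <-].
apply: (sub_supported _ (supported_join _ Ss (fun x => below_apex Ss))).
  by move=> t [].
exact/P_pi/simplex_last.
Qed.

Lemma supported_boundary_simplex n c :
  supported (fun s => simplex s /\ size s = n.+1) c ->
  supported (fun s => simplex s /\ size s = n) (boundary c).
Proof.
move=> sc; apply: supported_boundary sc _ => s t [Ss es] ts e.
by split; [apply: simplex_sub Ss | apply: succn_inj; rewrite -e].
Qed.

(* In [descend << s >>] the faces containing the last vertex of [s] cancel,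
   because the apex only depends on that vertex. *)
Lemma supported_descend s : simplex s ->
  supported (fun t => simplex t /\ lower (last o t) (last o s))
    (descend << s >>).
Proof.
move=> Ss; rewrite /descend malg_liftU -(boundary_join (p := apex s));
  last first.
  by apply: (notin_behead Ss) => x; apply: below_apex.
rewrite [boundary _ + _]addrC addrK; case/lastP: s Ss => [|s m] Ss.
  by rewrite /= !raddf0 addr0; apply: supported0.
rewrite face_rcons !raddfD /= !raddfMz /= malg_liftU homotopyU.
have -> : homotopy (malg_lift (fun t => << rcons t m >>) (face s)) =
    malg_lift (join (apex (rcons s m)))
      (malg_lift (fun t => << rcons t m >>) (face s)).
  rewrite !raddf_lift; apply: eq_malg_lift => t _ /=.
  by rewrite homotopyU malg_liftU /apex !last_rcons.
(* Only the face [s] omitting [m] is left: up to sign, the difference of its joins with the apex of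
   [rcons s m] and with its own apex. *)
rewrite addrACA subrr add0r -mulrzDl; apply: supportedMz.
have Pm : P m by case: Ss => _; apply; rewrite mem_rcons mem_head.
have rm x : x \in s -> r x m.
  by case: Ss => + _ xs; rewrite pairwise_rcons => /andP[/allP->].
(* The vertex [o] can only end a one-vertex chain: from [r x o], [pi_cone] would give [o = x] or
   [r o x], against asymmetry. For that chain both joins have apex [o] and cancel. *)
have {}mo : s = [::] /\ m = o \/ m <> o.
  case: (eqVneq m o) => [mo|/eqP]; [left|by right]; split=> //.
  case: s Ss rm => // x s [_ Ps] /(_ x (mem_head _ _)) rxm.
  have Px : P x by apply: Ps; rewrite mem_head.
  have := pi_cone Px Pm rxm; rewrite mo pio in rxm *.
  by case=> [e|/r_asym/(_ rxm)//]; rewrite e in rxm; case: (r_asym rxm rxm).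
have St : simplex s by apply: simplex_sub Ss; apply: subseq_rcons.
rewrite last_rcons; case: mo => [[-> ->]|mo].
  by rewrite /apex /= subrr; apply: supported0.
(* The added vertex [p] is the last one only when [s] is empty; it is then [pi m], or [o] as the
   apex of the empty chain. *)
have lower_last p : P p -> p = pi m \/ p = o -> lower (last p s) m.
  move=> Pp pE; case: (s) rm St => [_ _|x t rm [_ Pt]].
    split=> //=; case: pE => ->; [left|by right].
    by case: (pi_lower Pm mo).
  have xt : last p (x :: t) \in x :: t by rewrite /= mem_last.
  by split; [apply: Pt | | left; apply: rm].
apply: supportedB.
  have Pp : P (apex (rcons s m)) by rewrite /apex last_rcons; apply: P_pi.
  apply: sub_supported (supported_join Pp St _) => [t [St' _ et]|x xs].
    by rewrite et in St' *; split=> //=; apply: lower_last;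
      rewrite // /apex last_rcons; left.
  by apply: below_apex; rewrite // mem_rcons inE xs orbT.
apply: sub_supported (supported_join _ St (fun x => below_apex St)).
  move=> t [St' _ et]; rewrite et in St' *; split=> //=; rewrite /apex.
  by case: (s) lower_last =>
    [/(_ o Po (or_intror erefl))|x t' /(_ o Po (or_intror erefl))] //=;
      rewrite pio.
exact/P_pi/simplex_last.
Qed.

(** Well-founded induction on the last vertex of a simplex. A finite combination of chains, each
    killed by some power of [descend], is killed by the power whose exponent is their sum. *)
Lemma descend_nilpotent c : supported simplex c ->
  exists n, iter n descend c = 0.
Proof.
have iter0 n : iter n descend 0 = 0 by elim: n => //= n ->; rewrite raddf0.
have iterDr n c1 c2 :
    iter n descend (c1 + c2) = iter n descend c1 + iter n descend c2.
  by elim: n => //= n ->; rewrite raddfD.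
have iterMz n z c1 : iter n descend (c1 *~ z) = iter n descend c1 *~ z.
  by elim: n => //= n ->; rewrite raddfMz.
have nil_supp d : supported (fun s => exists n, iter n descend << s >> = 0) d ->
    exists n, iter n descend d = 0.
  move=> sd; rewrite -(malg_lift_id d) /malg_lift big_seq.
  elim/big_ind: _ => [|c2 c3 [n2 e2] [n3 e3]|s /sd[n e]]; first by exists 0.
  - by exists (n2 + n3)%N; rewrite iterDr {1}addnC !iterD e2 e3 !iter0 addr0.
  - by exists n; rewrite iterMz e mul0rz.
move=> sc; apply: (nil_supp) => s /sc Ss; have := lower_wf (simplex_last Ss).
move mE: (last o s) => m am; elim: am s mE Ss {sc} => {}m _ IH s mE Ss.
have [t /(supported_descend Ss)[St tl]|n e] := nil_supp (descend << s >>).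
  by apply: (IH (last o t)) => //; rewrite -mE.
by exists n.+1; rewrite iterSr.
Qed.

(** On a cycle, [descend c] is [c - boundary (homotopy c)], so a filling of [descend c] yields one
    of [c]; the induction is on the exponent that kills [c]. *)
Lemma simplex_exact n c : supported (fun s => simplex s /\ size s = n) c ->
    boundary c = 0 ->
  exists2 b, supported (fun s => simplex s /\ size s = n.+1) b & boundary b = c.
Proof.
move=> sc; have [k] :=
  descend_nilpotent (sub_supported (fun s => @proj1 _ _) sc).
elim: k c sc => [|k IHk] c sc.
  by move=> /= -> _; exists 0; [apply: supported0 | exact: raddf0].
rewrite iterSr => ek dc.
have eE : descend c = c - boundary (homotopy c).
  by rewrite descendE dc raddf0 subr0.
have shc := supported_homotopy sc.
have [||b sb eb] := IHk (descend c) _ ek.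
- by rewrite eE; apply: supportedB => //; apply: supported_boundary_simplex.
- by rewrite eE raddfB /= boundaryK dc subr0.
exists (b + homotopy c); first exact: supportedD.
by rewrite raddfD /= eb eE subrK.
Qed.

End Chains.

(** * The complex of step chains in a group *)

Section FreeModule.
Variable R : nzRingType.

Lemma ffun_free (I : finType) : free_of_finite_rank {ffun I -> R^o}.
Proof.
exists #|I|, (fun i => [ffun a => (a == enum_val i)%:R] : {ffun I -> R^o}) => v.
have vE (c : {ffun 'I_#|I| -> R}) a :
    (\sum_(i < #|I|)
      c i *: ([ffun b => (b == enum_val i)%:R] : {ffun I -> R^o})) a
      = c (enum_rank a).
  rewrite sum_ffunE (bigD1 (enum_rank a)) //= !ffunE enum_rankK eqxx.
  rewrite big1 ?addr0 => [|i ia]; first by rewrite /GRing.scale /= mulr1.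
  rewrite !ffunE; case: eqP => [e|_]; last exact: scaler0.
  by rewrite e enum_valK eqxx in ia.
exists [ffun i => v (enum_val i)]; split=> [|c vc].
  by apply/ffunP => a; rewrite vE ffunE enum_rankK.
by apply/ffunP => i; rewrite ffunE vc vE enum_valK.
Qed.

Variables (I : finType) (V : lmodType R) (D : I -> V).

Definition lin_ext (v : {ffun I -> R^o}) : V := \sum_a (v a : R) *: D a.

Lemma lin_ext_is_linear : linear lin_ext.
Proof.
move=> k u v; rewrite /lin_ext scaler_sumr -big_split; apply: eq_bigr => a _ /=.
by rewrite !ffunE scalerDl scalerA.
Qed.

HB.instance Definition _ :=
  GRing.isLinear.Build R {ffun I -> R^o} V _ lin_ext lin_ext_is_linear.

End FreeModule.

Section GroupChains.
Variable G : groupType.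
Local Notation ZG := (group_ring G).
Local Notation C := {malg int[seq G]}.
Implicit Types (g h : G) (s t : seq G) (c : C).

Lemma malg_lift_mul (V : zmodType) (phi : G -> V) (x y : ZG) :
  malg_lift phi (x * y)
    = malg_lift (fun g => malg_lift (fun h => phi (g * h)%g) y) x.
Proof.
rewrite /GRing.mul /= /gr_mul raddf_sum; apply: eq_bigr => g _ /=.
rewrite raddf_sum [malg_lift _ y]/malg_lift mulrz_suml;
  apply: eq_bigr => h _ /=.
by rewrite (malg_liftw _ msuppU_le) big_seq_fset1 mcoeffUU mulrC mulrzA.
Qed.

Definition shift g s := [seq (g * x)%g | x <- s].
Arguments shift : simpl never.

Lemma shift_cons g x s : shift g (x :: s) = (g * x)%g :: shift g s.
Proof. by []. Qed.

Lemma shiftM g h s : shift (g * h)%g s = shift g (shift h s).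
Proof. by rewrite /shift -map_comp; apply: eq_map => x /=; rewrite mulgA. Qed.

Lemma shift1 s : shift 1%g s = s.
Proof. by rewrite /shift (eq_map (@mul1g G)) map_id. Qed.

Definition act g : C -> C := malg_lift (fun s => << shift g s >>).
HB.instance Definition _ g := GRing.Additive.on (act g).

Lemma actU g s : act g << s >> = << shift g s >>.
Proof. exact: malg_liftU. Qed.

Lemma actK g c : act g (act g^-1%g c) = c.
Proof.
rewrite raddf_lift -[RHS]malg_lift_id; apply: eq_malg_lift => s _ /=.
by rewrite actU -shiftM mulgV shift1.
Qed.

Lemma act_cone g x c : act g (cone x c) = cone (g * x)%g (act g c).
Proof.
by rewrite !raddf_lift; apply: eq_malg_lift => t _ /=;
  rewrite actU /cone malg_liftU.
Qed.

Lemma act_face g s : act g (face s) = face (shift g s).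
Proof.
elim: s => [|x s IHs] /=; first exact: raddf0.
by rewrite raddfB /= actU act_cone IHs.
Qed.

Lemma act_boundary g c : act g (boundary c) = boundary (act g c).
Proof.
rewrite !raddf_lift; apply: eq_malg_lift => s _ /=.
by rewrite boundaryU act_face.
Qed.

(** * Step chains and their orbits under translation *)

Variable S : seq G.

Definition step g h := (g != h) && ((g^-1 * h)%g \in S).

(* [n] counts vertices, so it exceeds the simplicial degree by one. *)
Definition step_chain n s := pairwise step s /\ size s = n.

Lemma step_chain_shift g n s : step_chain n s -> step_chain n (shift g s).
Proof.
move=> [ps <-]; split; last exact: size_map.
rewrite pairwise_map; apply: sub_pairwise ps => x y.
by rewrite /step /= invgM -mulgA mulKg (inj_eq (mulgI g)).
Qed.

Lemma supported_act g n c : supported (step_chain n) c ->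
  supported (step_chain n) (act g c).
Proof.
by move=> sc; apply: supported_lift sc _ => s ss; apply: supportedU;
  apply: step_chain_shift.
Qed.

Fixpoint words n : seq (seq G) :=
  if n is m.+1 then [seq x :: s | x <- S, s <- words m] else [:: [::]].

Lemma mem_words n s : (s \in words n) = (size s == n) && all [in S] s.
Proof.
elim: n s => [|n IHn] [|x s] //=; first by apply/allpairsP => -[[]] /= ? ? [].
rewrite eqSS andbCA -IHn;
  apply/allpairsP/andP => [[[y t] /= [yS tw [-> ->]]] //|[xS sw]].
by exists (x, s).
Qed.

(* The tails of the step chains from 1: orbit representatives in degree [n]. *)
Definition cells n := [seq s <- words n | pairwise step (1%g :: s)].

Lemma mem_cells n s : reflect (step_chain n.+1 (1%g :: s)) (s \in cells n).
Proof.
rewrite mem_filter mem_words;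
  apply: (iffP andP) => [[ps /andP[/eqP <- _]]//|[ps [<-]]].
rewrite ps eqxx; split=> //; apply/allP => x xs;
  case/andP: ps => /allP/(_ x xs) + _.
by rewrite /step invg1 mul1g => /andP[].
Qed.

(** The vertices after 1 are pairwise distinct elements of [S]. *)
Lemma cells_nil n : (size S < n)%N -> cells n = [::].
Proof.
move=> ltSn; case E: (cells n) => [//|s l].
have : s \in cells n by rewrite E mem_head.
move=> sn; have [ps _] := mem_cells _ _ sn; move: sn;
  rewrite mem_filter mem_words.
case/and3P => _ /eqP ss /allP sS; have : uniq s.
  rewrite uniq_pairwise; case/andP: ps => _; apply: sub_pairwise => x y.
  by case/andP.
by move/uniq_leq_size => /(_ S sS); rewrite ss leqNgt ltSn.
Qed.

Definition chain_module n : lmodType ZG := {ffun seq_sub (cells n) -> ZG^o}.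

Definition cell n (a : seq_sub (cells n)) : seq G := 1%g :: ssval a.
Arguments cell : simpl never.

Lemma cellP n (a : seq_sub (cells n)) : step_chain n.+1 (cell a).
Proof. exact/mem_cells/ssvalP. Qed.

(** Identifies the free module with the chains supported on step chains: translation is free, and a
    step chain with first vertex [g] is the translate by [g] of exactly one cell. *)
Definition to_chain n (v : chain_module n) : C :=
  \sum_a malg_lift (fun g => << shift g (cell a) >>) (v a).

Lemma to_chain_is_zmod_morphism n : zmod_morphism (@to_chain n).
Proof.
move=> u v; rewrite -sumrB; apply: eq_bigr => a _.
by rewrite !ffunE raddfB.
Qed.

HB.instance Definition _ n := GRing.isZmodMorphism.Build (chain_module n) C
  (@to_chain n) (@to_chain_is_zmod_morphism n).

(** The default head 1 is harmless: cells are nonempty, so the empty sequence matches none and goes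
    to 0. *)
Definition of_chain n : C -> chain_module n := malg_lift (fun s =>
  [ffun a => if s == shift (head 1%g s) (cell a) then << head 1%g s >> else 0]).
HB.instance Definition _ n := GRing.Additive.on (@of_chain n).

Lemma supported_to_chain n (v : chain_module n) :
  supported (step_chain n.+1) (to_chain v).
Proof.
rewrite /to_chain; elim/big_ind: _ => [|x y|a _]; first exact: supported0.
  exact: supportedD.
apply: (@supported_lift _ _ (fun => True)) => // g _.
by apply: supportedU; apply: step_chain_shift; apply: cellP.
Qed.

Lemma of_chainK n c : supported (step_chain n.+1) c ->
  to_chain (of_chain n c) = c.
Proof.
move=> sc; rewrite raddf_lift -[RHS]malg_lift_id.
apply: eq_malg_lift => s /sc ss /=.
case: s ss => [[]//|g s] ss /=.
have scell : shift g^-1%g s \in cells n.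
  apply/mem_cells; have := step_chain_shift g^-1%g ss.
  by rewrite shift_cons mulVg.
have sE : g :: s = shift g (cell (SeqSub scell)).
  by rewrite shift_cons mulg1 -shiftM mulgV shift1.
rewrite /to_chain (bigD1 (SeqSub scell)) //= ffunE -sE eqxx malg_liftU -sE.
rewrite big1 ?addr0 // => a /eqP ane; rewrite ffunE.
case: eqP => [|_]; last exact: raddf0.
by rewrite {1}sE => /(inj_map (mulgI g)) [e]; case: ane; apply: val_inj.
Qed.

Lemma to_chain_coef n (v : chain_module n) a g :
  (to_chain v)@_(shift g (cell a)) = (v a)@_g.
Proof.
rewrite raddf_sum (bigD1 a) //= big1 ?addr0 => [|b ba]; rewrite !raddf_lift.
  rewrite [RHS]raddf_malg; apply: eq_malg_lift => h _ /=.
  rewrite !mcoeffU; congr (_ *+ nat_of_bool _); apply/eqP/eqP => [[]|-> //].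
  by rewrite !mulg1.
rewrite /malg_lift big1 // => h _; rewrite /= mcoeffU; case: eqP => [[]|_];
  last by rewrite mul0rz.
rewrite !mulg1 => -> /(inj_map (mulgI g)) e; case/eqP: ba.
exact: val_inj.
Qed.

Lemma to_chain_inj n : injective (@to_chain n).
Proof.
move=> u v e; apply/ffunP => a; apply/malgP => g.
by rewrite -!to_chain_coef e.
Qed.

Lemma to_chainZ n (x : ZG) (v : chain_module n) :
  to_chain (x *: v) = malg_lift (fun g => act g (to_chain v)) x.
Proof.
transitivity (\sum_a malg_lift
    (fun g => malg_lift (fun h => << shift (g * h)%g (cell a) >> : C) (v a)) x).
  by apply: eq_bigr => a _; rewrite ffunE malg_lift_mul.
have actE g : act g (to_chain v) =
    \sum_a malg_lift (fun h => << shift (g * h)%g (cell a) >>) (v a).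
  rewrite raddf_sum; apply: eq_bigr => a _ /=; rewrite raddf_lift.
  by apply: eq_malg_lift => h _; rewrite /= actU shiftM.
by rewrite exchange_big; apply: eq_bigr => g _ /=; rewrite actE mulrz_suml.
Qed.

(** * Differential, augmentation and resolution *)

Definition differential n : chain_module n.+1 -> chain_module n :=
  lin_ext (fun a => of_chain n (face (cell a))).
HB.instance Definition _ n := GRing.Linear.on (@differential n).

Lemma supported_boundary_step n c : supported (step_chain n.+1) c ->
  supported (step_chain n) (boundary c).
Proof.
move=> sc; apply: supported_boundary sc _ => s t [ps es] ts e.
by split; [apply: subseq_pairwise ps | apply: succn_inj; rewrite -e].
Qed.

(** Faces commute with translation, so it is enough to compare both sides on cells. *)
Lemma to_chain_differential n (v : chain_module n.+1) :
  to_chain (differential v) = boundary (to_chain v).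
Proof.
have faceK a : to_chain (of_chain n (face (cell a))) = face (@cell n.+1 a).
  rewrite of_chainK // -boundaryU.
  by apply: supported_boundary_step; apply: supportedU; apply: cellP.
rewrite raddf_sum [in RHS]raddf_sum; apply: eq_bigr => a _.
rewrite -[LHS]/(to_chain ((v a : ZG) *: of_chain n (face (cell a)))) to_chainZ
  faceK.
rewrite [RHS]raddf_lift; apply: eq_malg_lift => g _.
by rewrite act_face -boundaryU.
Qed.

Definition base_augmentation : chain_module 0 -> trivial_module G :=
  lin_ext (fun=> 1 : trivial_module G).
HB.instance Definition _ := GRing.Linear.on base_augmentation.

(** The multiples of the empty sequence form degree -1 of the simplicial complex and play the part
    of the trivial module. *)
Lemma boundary_to_chain0 (v : chain_module 0) :
  boundary (to_chain v) = << [::] >> *~ base_augmentation v.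
Proof.
rewrite raddf_sum /base_augmentation /lin_ext mulrz_sumr; apply: eq_bigr => a _.
rewrite raddf_lift [_ *: _]mulr1 [augmentation _]/augmentation mulrz_sumr.
apply: eq_bigr => g _; congr (_ *~ _); rewrite /= boundaryU.
have [_] := cellP a; rewrite /cell; case: (ssval a) => //= _.
by rewrite raddf0 subr0.
Qed.

Lemma step_exact_resolution :
    (forall n c, supported (step_chain n) c -> boundary c = 0 ->
       exists2 b, supported (step_chain n.+1) b & boundary b = c) ->
  type_FL G.
Proof.
move=> exC.
have exF n (v : chain_module n) : boundary (to_chain v) = 0 ->
    exists y, v = differential (n := n) y.
  case/(exC _ _ (@supported_to_chain _ v)) => b sb eb.
  exists (of_chain n.+1 b); apply: to_chain_inj.
  by rewrite to_chain_differential of_chainK.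
exists (size S), chain_module, (fun n => @differential n : {linear _ -> _}),
  (base_augmentation : {linear _ -> _}).
split=> [n _|n ltn v|z|v|n v].
- exact: ffun_free.
- by apply/ffunP => a; have := ssvalP a; rewrite {2}cells_nil.
(* Surjectivity of the augmentation is exactness at the empty sequence, all of whose multiples are
   cycles. *)
- have [||b sb eb] := exC 0%N (<< [::] >> *~ z).
  + by apply: supportedMz; apply: supportedU.
  + by rewrite raddfMz /= boundaryU mul0rz.
  exists (of_chain 0 b); have := boundary_to_chain0 (of_chain 0 b).
  rewrite of_chainK // eb => /(congr1 (mcoeff [::])).
  by rewrite !raddfMz /= mcoeffUU !intz.
- split=> [ev|[y ->]].
    by apply: exF; rewrite boundary_to_chain0 /= ev mulr0z.
  have /(congr1 (mcoeff [::])) := boundary_to_chain0 (differential y).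
  rewrite to_chain_differential boundaryK mcoeff0 raddfMz /= mcoeffUU intz.
  by move=> <-.
- split=> [dv|[y ->]].
    by apply: exF; rewrite -to_chain_differential dv raddf0.
  apply: to_chain_inj; rewrite !to_chain_differential boundaryK.
  by rewrite raddf0.
Qed.

End GroupChains.

(** * Garside monoids *)

Section GarsideMonoid.
Local Open Scope group_scope.
Variable M : monoidType.
Hypotheses (noeth : left_noetherian M) (rcanc : right_cancellative M)
  (lcmM : forall x y : M, exists m, left_lcm x y m).
Implicit Types (x y m s t : M).

Lemma mulM_eq1 x y : x * y = 1 -> x = 1.
Proof.
move=> xy; apply: contrapT => x1; apply: noeth.
(* If [x] is not 1, then neither is [y], and 1 and [x] are proper left divisors of each other. *)
exists (fun i => if odd i then x else 1) => i /=; case: (odd i) => /=.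
  by exists x; rewrite ?mul1g.
by exists y => // y1; rewrite y1 mulg1 in xy.
Qed.

(** An inaccessible element has an inaccessible proper left divisor; choice iterates this into an
    infinite descent. *)
Lemma proper_left_divisor_wf x : Acc (@proper_left_divisor M) x.
Proof.
apply: contrapT => nx; pose B := {y | ~ Acc (@proper_left_divisor M) y}.
have [next nextP] :
    {F : B -> B & forall b, proper_left_divisor (sval (F b)) (sval b)}.
  apply: (choice (P := fun b b' : B => proper_left_divisor (sval b') (sval b))).
  move=> [y ny] /=; apply: contrapT => nB; apply: ny.
  constructor=> z zy; apply: contrapT => nz; apply: nB.
  by exists (exist _ z nz).
apply: noeth; exists (fun i => sval (iter i next (exist _ x nx))) => i.
exact: nextP.
Qed.

Lemma right_divisor_trans x y m :
  right_divisor x y -> right_divisor y m -> right_divisor x m.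
Proof. by move=> [a ->] [b ->]; exists (b * a); rewrite mulgA. Qed.

Lemma left_lcm_divisor x y m : right_divisor x y -> left_lcm x y m -> m = y.
Proof.
move=> xy [_ [c mE] /(_ y xy)[|d yE]]; first by exists 1; rewrite mul1g.
have /mulM_eq1 d1 : d * c = 1.
  by apply: (rcanc (z := y)); rewrite mul1g -mulgA -mE -yE.
by rewrite yE d1 mul1g.
Qed.

Variable X : seq M.
Hypothesis XG : garside_generators X.

Lemma left_lcm_generators x y m :
  x \in 1 :: X -> y \in 1 :: X -> left_lcm x y m -> m \in 1 :: X.
Proof.
have lcm1 (z w : M) : left_lcm 1 z w -> w = z.
  by apply: left_lcm_divisor; exists z; rewrite mulg1.
rewrite !inE => /predU1P[->|xX] /predU1P[->|yX].
- by move/lcm1 ->; rewrite eqxx.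
- by move/lcm1 ->; rewrite yX orbT.
- move=> [xm ym lm]; have /lcm1 -> : left_lcm 1 x m by split=> // n /lm.
  by rewrite xX orbT.
- by move=> lm; have [_ /(_ x y xX yX)[/(_ m lm) -> _ _ _]] := XG; rewrite orbT.
Qed.

(** The left lcm of [c * s] and [s] is [c * s] itself, so [c] is a left complement. *)
Lemma left_complement_generators s c :
  s \in 1 :: X -> c * s \in 1 :: X -> c \in 1 :: X.
Proof.
rewrite 2!inE => /predU1P[->|sX]; first by rewrite mulg1.
case/predU1P => [/mulM_eq1 ->|csX]; first exact: mem_head.
have [_ /(_ (c * s) s csX sX)[_ _ + _]] := XG; apply.
by split=> [||n //]; [exists 1; rewrite mul1g | exists c].
Qed.

(** Take the left lcm of all right divisors of [m] in the finite list [1 :: X]: it stays in the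
    list, and it divides [m], which is a common left multiple of them. *)
Lemma greatest_right_divisor m : exists t, [/\ t \in 1 :: X, right_divisor t m
  & forall s, s \in 1 :: X -> right_divisor s m -> right_divisor s t].
Proof.
suff gen (Y : seq M) : {subset Y <= 1 :: X} -> exists t, [/\ t \in 1 :: X,
    right_divisor t m & forall s, s \in Y -> right_divisor s m ->
      right_divisor s t].
  exact: gen.
elim: Y => [_|y Y IHY yYX].
  by exists 1; split=> //; [rewrite mem_head | exists m; rewrite mulg1].
have [z zY|t [tX tm tY]] := IHY; first by apply: yYX; rewrite inE zY orbT.
have [ym|nym] := pselect (right_divisor y m); last first.
  by exists t; split=> // s; rewrite inE => /predU1P[->|/tY].
have [u tyu] := lcmM t y; have [tu yu um] := tyu.
exists u; split=> [||s]; last 1 first.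
- rewrite inE => /predU1P[-> //|sY] /(tY _ sY) st.
  exact: right_divisor_trans tu.
- by apply: left_lcm_generators tyu => //; apply: yYX; rewrite mem_head.
- exact: um.
Qed.

Lemma generator_right_divisor m : m <> 1 ->
  exists2 x, x \in 1 :: X & x <> 1 /\ right_divisor x m.
Proof.
case: XG => /(_ m)[l lX ->] _; elim/last_ind: l lX => [|l x IHl] lX.
  by rewrite big_nil.
have xX : x \in 1 :: X by rewrite inE lX ?orbT // mem_rcons mem_head.
rewrite -cats1 big_cat big_seq1 /=; case: (eqVneq x 1) => [->|/eqP x1 _].
  rewrite mulg1; apply: IHl => y yl; apply: lX.
  by rewrite mem_rcons inE yl orbT.
by exists x => //; split=> //; exists (\prod_(y <- l) y).
Qed.

(** * Step chains in the group of fractions *)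

Section Fractions.
Variables (G : groupType) (f : M -> G).
Hypotheses (f1 : f 1 = 1) (fM : {morph f : x y / x * y}) (f_inj : injective f)
  (fracM : forall g : G, exists x y, g = (f x)^-1 * f y).

Let S := map f (1 :: X).
Let P g := exists x, g = f x.

Lemma step_imP x y : step S (f x) (f y) ->
  exists s, [/\ s \in 1 :: X, s <> 1 & y = x * s].
Proof.
case/andP => /eqP xy /mapP[s sX e]; exists s.
have yE : y = x * s by apply: f_inj; rewrite fM -e mulVKg.
by split=> // s1; apply: xy; rewrite yE s1 mulg1.
Qed.

Lemma step_im x s : s \in 1 :: X -> s <> 1 -> step S (f x) (f (x * s)).
Proof.
move=> sX s1; rewrite /step fM mulKg map_f // andbT; apply/eqP => e.
by apply: s1; apply: f_inj; rewrite f1; apply: (mulgI (f x)); rewrite -e mulg1.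
Qed.

Lemma step_asym g h : step S g h -> step S h g -> False.
Proof.
case/andP => gh /mapP[s _ e] /andP[_ /mapP[t _ e']].
have /mulM_eq1 s1 : s * t = 1.
  by apply: f_inj; rewrite fM f1 -e -e' mulgA mulgK mulVg.
by case/eqP: gh; apply: (mulgI g^-1); rewrite e s1 f1 mulVg.
Qed.

(** Both alternatives of [lower] give proper left divisors in [M]: a step from [y] ends at [y * s]
    with [s <> 1], and 1 properly divides every other element. *)
Lemma lower_im_wf g : P g -> Acc (lower (step S) P 1) g.
Proof.
case=> x ->; elim: (proper_left_divisor_wf x) => {}x _ IHx.
constructor=> _ [[y ->] _ yx]; apply: IHx;
  case: yx => [/step_imP[s [_ s1 ->]]|[y1 x1]].
  by exists s.
have -> : y = 1 by apply: f_inj; rewrite f1.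
by exists x; rewrite ?mul1g // => e; apply: x1; rewrite e f1.
Qed.

(** A common left multiple of [w] and of the denominator of [g] clears [g], and still clears all
    that [w] did. *)
Lemma common_denominator (l : seq G) : exists w, forall g, g \in l -> P (w * g).
Proof.
suff [w wl] : exists w, forall g, g \in l -> P (f w * g) by exists (f w).
elim: l => [|g l [w wl]]; first by exists 1.
have [x [y gE]] := fracM g; have [m [[a ma] [b mb] _]] := lcmM w x.
exists m => h; rewrite inE => /predU1P[->|/wl[z zE]].
  by exists (b * y); rewrite gE mb !fM -mulgA mulVKg.
by exists (a * z); rewrite ma !fM -mulgA zE.
Qed.

Lemma apex_exists : exists pi : G -> G, [/\ pi 1 = 1,
    forall g, P g -> g <> 1 -> P (pi g) /\ step S (pi g) g
  & forall g h, P g -> P h -> step S g h -> pi h = g \/ step S (pi h) g].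
Proof.
(* The condition is vacuous outside the image of [M], so a total choice function exists. *)
pose head_split g h := forall x, g = f x -> exists q t,
  [/\ h = f q, x = q * t, t \in 1 :: X
    & forall s, s \in 1 :: X -> right_divisor s x -> right_divisor s t].
have [apex apexP] : {apex : G -> G & forall g, head_split g (apex g)}.
  apply: (choice (P := head_split)) => g.
  case: (pselect (P g)) => [[x ->]|nP]; last by exists 1 => x gx; case: nP;
    exists x.
  have [t [tX [q xE] tP]] := greatest_right_divisor x.
  by exists (f q) => _ /f_inj <-; exists q, t.
exists apex; split.
- have [q [t [-> /esym/mulM_eq1 -> _ _]]] := apexP 1 1 (esym f1).
  exact: f1.
- move=> _ [x ->] x1; have [q [t [-> xE tX tP]]] := apexP (f x) x erefl.
  split; first by exists q.
  (* Some generator other than 1 right-divides [x], hence also [t]; [t = 1] would make it a divisor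
     of 1. *)
  rewrite [X in step S _ (f X)]xE; apply: step_im => // t1.
  have [|s sX [s1 sx]] := @generator_right_divisor x.
    by move=> e; apply: x1; rewrite e.
  have [c /esym cs] := tP s sX sx; apply: s1; rewrite t1 in cs.
  by move: (cs); rewrite (mulM_eq1 cs) mul1g.
(* Here [y = x * s = q * t], and maximality gives [t = c * s]. Right cancellation yields
   [x = q * c], and closure under complements makes [c] a step or 1. *)
- move=> _ _ [x ->] [y ->] /step_imP[s [sX s1 yE]].
  have [q [t [-> yqt tX tP]]] := apexP (f y) y erefl.
  have [|c tE] := tP s sX; first by exists x.
  have cX : c \in 1 :: X by apply: left_complement_generators sX _; rewrite -tE.
  have xE : x = q * c by apply: (rcanc (z := s)); rewrite -yE yqt tE mulgA.
  rewrite xE; case: (eqVneq c 1) => [->|/eqP c1]; first by left; rewrite mulg1.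
  by right; apply: step_im.
Qed.

Local Close Scope group_scope.

Lemma step_exact n (c : {malg int[seq G]}) :
    supported (step_chain S n) c -> boundary c = 0%R ->
  exists2 b, supported (step_chain S n.+1) b & boundary b = c.
Proof.
move=> sc dc; have [w wP] := common_denominator (flatten (msupp c)).
have [pi [pi1 piP piC]] := apex_exists.
have P1 : P 1%g by exists 1%g; rewrite f1.
have [||b sb eb] := @simplex_exact _ (step S) P 1%g pi P1 pi1 step_asym piP piC
    lower_im_wf n (act w c).
- have sc' : supported (fun l => step_chain S n l /\ l \in msupp c) c.
    by move=> l lc; split=> //; apply: sc.
  apply: supported_lift sc' _ => l [sl lc]; apply: supportedU;
    have [pl el] := step_chain_shift w sl.
  split=> //; split=> // _ /mapP[x xl ->]; apply: wP.
  by apply/flattenP; exists l.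
- by rewrite -act_boundary dc raddf0.
exists (act w^-1%g b).
  by apply: supported_act => l /sb[[]].
by rewrite -act_boundary eb -{2}(invgK w) actK.
Qed.

End Fractions.
End GarsideMonoid.

Theorem corollary0p2 (G : groupType) : garside_group G -> type_FL G.
Proof.
move=> [M [f [[[[rcanc noeth lcmM] _] [X XG]] [f1 fM f_inj fracM]]]].
apply: step_exact_resolution => n c.
exact: (step_exact noeth rcanc lcmM XG f1 fM f_inj fracM).
Qed.
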